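(* Suppose that there exists an approximation algorithm for $\textsc{Min-Max}~\mathcal{P}$ with a worst case ratio of $\gamma>1$. Let $\hat X\in\Phi$ be a solution constructed by this algorithm. Then for any $\alpha\in(0,1]$ and any $X\in\Phi$ it holds $$\mathrm{OWA}(\hat X)\le\begin{cases}\gamma\cdot\mathrm{OWA}(X)&\text{if }\alpha=1\text{ or }\min_{1\le j\le K}F(\hat X,\pmb{c}_j)=0,\\[2pt]\dfrac{\gamma}{\alpha}\cdot\mathrm{OWA}(X)&\text{if }\alpha\in(0,1),\end{cases}$$ where $\mathrm{OWA}(X)=\alpha\max_{1\le j\le K}F(X,\pmb{c}_j)+(1-\alpha)\min_{1\le j\le K}F(X,\pmb{c}_j)$ is the Hurwicz criterion.
   Context: An instance of $\textsc{Min-Max}~\mathcal{P}$ consists of a finite set of elements $E=\{e_1,\dots,e_n\}$, a (nonempty) set of feasible solutions $\Phi\subseteq2^E$ of the combinatorial optimization problem $\mathcal{P}$, and a scenario set $\Gamma=\{\pmb{c}_1,\dots,\pmb{c}_K\}$ of $K$ distinct cost scenarios $\pmb{c}_j=(c_{1j},\dots,c_{nj})$ with nonnegative entries. With $F(X,\pmb{c}_j)=\sum_{e_i\in X}c_{ij}$, $\textsc{Min-Max}~\mathcal{P}$ is the problem $\min_{X\in\Phi}\max_{1\le j\le K}F(X,\pmb{c}_j)$. An approximation algorithm with worst case ratio $\gamma$ returns, for every instance, some $\hat X\in\Phi$ with $\max_jF(\hat X,\pmb{c}_j)\le\gamma\min_{X\in\Phi}\max_jF(X,\pmb{c}_j)$.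 In the statement, $\hat X$ is the algorithm's output on the same $E,\Phi,\Gamma$ for which the Hurwicz criterion is evaluated. *)

(* Defs.v *)
From mathcomp Require Import all_boot all_order all_algebra.
Set Implicit Arguments.
Unset Strict Implicit.
Unset Printing Implicit Defensive.
Import Order.TTheory GRing.Theory Num.Theory.
Local Open Scope ring_scope.

(* A combinatorial optimization problem is represented by the class of the
   families of feasible solutions, over the ground sets 'I_n, that it allows. *)
Definition problem := forall n : nat, {set {set 'I_n}} -> Prop.

(* There are [nscen_pred + 1] scenarios, so the scenario set is nonempty;
   [scenario j 0 i] is the cost of element i under scenario j. *)
Record instance (R : realFieldType) (P : problem) := Instance {
  nelem : nat;
  feasible : {set {set 'I_nelem}};
  feasibleP : P nelem feasible;
  feasible_neq0 : feasible != set0;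
  nscen_pred : nat;
  scenario : 'I_nscen_pred.+1 -> 'rV[R]_nelem;
  scenario_inj : injective scenario;
  scenario_ge0 : forall j i, 0 <= scenario j 0 i
}.

Definition solution (R : realFieldType) (P : problem) (I : instance R P) :=
  {set 'I_(nelem I)}.

Definition cost (R : realFieldType) (P : problem) (I : instance R P)
    (X : solution I) (j : 'I_(nscen_pred I).+1) : R :=
  \sum_(i in X) scenario j 0 i.

(* R has no least or greatest element, so each iterated max or min below is
   seeded with one of the values over which it ranges. *)
Definition max_cost (R : realFieldType) (P : problem) (I : instance R P)
    (X : solution I) : R :=
  \big[Num.max/cost X ord0]_(j < (nscen_pred I).+1) cost X j.

Definition min_cost (R : realFieldType) (P : problem) (I : instance R P)
    (X : solution I) : R :=
  \big[Num.min/cost X ord0]_(j < (nscen_pred I).+1) cost X j.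

Definition some_feasible (R : realFieldType) (P : problem) (I : instance R P) :
    solution I :=
  xchoose (set0Pn _ (feasible_neq0 I)).

Definition minmax_value (R : realFieldType) (P : problem) (I : instance R P) : R :=
  \big[Num.min/max_cost (some_feasible I)]_(X in feasible I)
    @max_cost R P I X.

Definition algorithm (R : realFieldType) (P : problem) :=
  forall I : instance R P, solution I.

Definition approximates (R : realFieldType) (P : problem) (gamma : R)
    (A : algorithm R P) : Prop :=
  forall I : instance R P,
    A I \in feasible I /\ max_cost (A I) <= gamma * minmax_value I.

(* The OWA operator specialized to the Hurwicz criterion. *)
Definition OWA (R : realFieldType) (P : problem) (I : instance R P) (alpha : R)
    (X : solution I) : R :=
  alpha * max_cost X + (1 - alpha) * min_cost X.

(* Main.v *)
Require Import Defs.
From mathcomp Require Import all_boot all_order all_algebra.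
Import Order.TTheory GRing.Theory Num.Theory.
Local Open Scope ring_scope.

(** With nonnegative costs and [alpha <= 1], the Hurwicz value is squeezed as [alpha * max_cost X <=
    OWA alpha X <= max_cost X] ([OWA_ge_max_cost], [OWA_le_max_cost]). The guarantee on [A] compares
    the maximal cost of [A I] with that of any feasible [X], because the optimum lies below the
    latter. Chaining the three bounds costs the factor [gamma / alpha]. If the minimum term of [A I]
    vanishes, its value is exactly [alpha * max_cost (A I)], so [alpha] appears on both sides and
    only [gamma] remains. *)

Lemma minmax_value_le (R : realFieldType) (P : problem) (I : instance R P)
    (X : solution I) : X \in feasible I -> minmax_value I <= max_cost X.
Proof. exact: bigmin_le_cond. Qed.

Lemma cost_ge0 (R : realFieldType) (P : problem) (I : instance R P)
    (X : solution I) j : 0 <= cost X j.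
Proof. by apply: sumr_ge0 => i _; exact: scenario_ge0. Qed.

Lemma min_cost_ge0 (R : realFieldType) (P : problem) (I : instance R P)
    (X : solution I) : 0 <= min_cost X.
Proof. by apply: le_bigmin => [|j _]; exact: cost_ge0. Qed.

(** The common seed [cost X ord0] lies between the two folds. *)
Lemma min_cost_le_max_cost (R : realFieldType) (P : problem) (I : instance R P)
    (X : solution I) : min_cost X <= max_cost X.
Proof. exact: le_trans (bigmin_le_id _ _ _ _) (bigmax_ge_id _ _ _ _). Qed.

Lemma OWA_le_max_cost (R : realFieldType) (P : problem) (I : instance R P)
    (alpha : R) (X : solution I) : alpha <= 1 -> OWA alpha X <= max_cost X.
Proof.
(* Writing [1] as [alpha + (1 - alpha)] splits the maximum into two terms; the [alpha] terms cancel,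
   leaving minimum against maximum with weight [1 - alpha]. *)
move=> alpha_le1; rewrite /OWA -[leRHS]mul1r -[X in _ <= X * _](subrKC alpha).
by rewrite [leRHS]mulrDl lerD2l ler_wpM2l ?subr_ge0 ?min_cost_le_max_cost.
Qed.

(** The minimum term being dropped is nonnegative; nonnegativity of the costs enters here. *)
Lemma OWA_ge_max_cost (R : realFieldType) (P : problem) (I : instance R P)
    (alpha : R) (X : solution I) :
  alpha <= 1 -> alpha * max_cost X <= OWA alpha X.
Proof.
by move=> alpha_le1; rewrite lerDl mulr_ge0 ?subr_ge0 ?min_cost_ge0.
Qed.

Theorem theorem8 (R : realFieldType) (P : problem) (gamma : R)
    (A : algorithm R P) (hgamma : 1 < gamma) (hA : approximates gamma A)
    (I : instance R P) (alpha : R) (halpha : 0 < alpha <= 1)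
    (X : solution I) (hX : X \in feasible I) :
  (alpha = 1 \/ min_cost (A I) = 0 ->
     OWA alpha (A I) <= gamma * OWA alpha X) /\
  (0 < alpha < 1 -> OWA alpha (A I) <= gamma / alpha * OWA alpha X).
Proof.
have [alpha_gt0 alpha_le1] := andP halpha.
have gamma_ge0 : 0 <= gamma by exact: ltW (lt_trans ltr01 hgamma).
have max_le : max_cost (A I) <= gamma * max_cost X.
  by apply: le_trans (hA I).2 _; rewrite ler_wpM2l ?minmax_value_le.
split=> [alpha1_or_min0 | _].
  (* Either alternative kills the term [(1 - alpha) * min_cost (A I)]. *)
  have -> : OWA alpha (A I) = alpha * max_cost (A I).
    by rewrite /OWA; case: alpha1_or_min0 => ->; rewrite ?subrr ?mul0r ?mulr0 addr0.
  apply: (@le_trans _ _ (gamma * (alpha * max_cost X))).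
    by rewrite mulrCA ler_wpM2l // ltW.
  by rewrite ler_wpM2l ?OWA_ge_max_cost.
(* Here the minimum of [A I] is only bounded by its maximum, so no factor [alpha] is left on this
   side, and the division by [alpha] must supply it. *)
apply: le_trans (OWA_le_max_cost _ _ _ _ _ alpha_le1) _.
apply: le_trans max_le _; rewrite -mulrA ler_wpM2l // ler_pdivlMl //.
exact: OWA_ge_max_cost.
Qed.
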